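(* Let $H$ be an $r$-partite hypergraph with at least one edge. Then there exist an edge $e\in H$ and a vertex $v\in e$ such that, with $S=e\setminus\{v\}$, we have $\nu^*(H-S)\le\nu^*(H)-1$.
   Context: A hypergraph is $r$-partite if its vertex set can be partitioned into $r$ sets (the sides) so that every edge contains exactly one vertex from each side. $H-S$ denotes the hypergraph obtained by deleting the vertices of $S$, i.e., consisting of the edges of $H$ disjoint from $S$. $\nu^*(H)$ is the fractional matching number: the maximum of $\sum_{e\in H}w_e$ over nonnegative weights $w_e$ on edges such that for every vertex the sum of weights of edges containing it is at most $1$ (by LP duality this equals the fractional covering number $\tau^*(H)$).
   Formalization: The formal theorem assumes r ≥ 2: for r = 1 every edge is a single vertex, so S is empty and the claim would read ν*(H) ≤ ν*(H) − 1, which is false; for r = 0 the only edge is empty and contains no vertex v. *)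

(* Defs.v *)
From mathcomp Require Import all_boot all_order all_algebra.
From mathcomp Require Import classical_sets reals.
Set Implicit Arguments.
Unset Strict Implicit.
Unset Printing Implicit Defensive.
Import Order.TTheory GRing.Theory Num.Theory.
Local Open Scope ring_scope.

(* A hypergraph on the vertex type T is its set of edges H : {set {set T}}. *)

(* finset.partition requires nonempty blocks; as each side must meet every
   edge, this restricts nothing as soon as H has an edge. *)
Definition rpartite (T : finType) (r : nat) (H : {set {set T}}) : Prop :=
  exists sides : {set {set T}},
    [/\ finset.partition sides (finset.setT : {set T}),
        #|sides| = r
      & forall e A : {set T}, e \in H -> A \in sides -> #|e :&: A| = 1%N].

Definition hdel (T : finType) (H : {set {set T}}) (S : {set T}) :
    {set {set T}} :=
  [set e in H | [disjoint e & S]]%SET.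

Definition fractional_matching (R : realType) (T : finType)
    (H : {set {set T}}) (w : {set T} -> R) : Prop :=
  (forall e, e \in H -> 0 <= w e) /\
  (forall v : T, \sum_(e in H | v \in e) w e <= 1).

(* The set below contains 0 and, when the edges are nonempty, it is bounded by
   #|H| and compact; its supremum is then a maximum. *)
Definition nu_star (R : realType) (T : finType) (H : {set {set T}}) : R :=
  sup [set x : R | exists2 w : {set T} -> R,
         fractional_matching H w & x = \sum_(e in H) w e]%classic.

(* Main.v *)
(* Let [t] be an optimal fractional cover and [w] an optimal fractional matching,
   both obtained from LP duality. If some edge [e] has [t]-weight exactly 1 and
   contains a vertex [v] with [t v = 0], then [t] restricted to the complement
   of [e :\ v] shows that deleting [e :\ v] lowers the optimum by at least 1.
   Otherwise, by complementary slackness, [w] saturates exactly the set [P] of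
   vertices with [t > 0], so all sides contain the same number of elements of
   [P]. Lowering [t] on one side of [P] and raising it equally on another side
   keeps the total weight; the cover stays feasible until either a vertex of [P]
   drops to 0, and any edge of the support of [w] through it is tight, or an
   edge with a vertex of [t]-weight 0 becomes tight. *)
Require Import Defs.
From mathcomp Require Import all_boot all_order all_algebra.
From mathcomp Require Import classical_sets reals.
From mathcomp Require Import ring lra.
Import Order.TTheory GRing.Theory Num.Theory.
Local Open Scope ring_scope.
Set Implicit Arguments.
Unset Strict Implicit.

(** * Strong duality of linear programming over an ordered field *)

Section LinearProgramming.
Variable R : realFieldType.

(* Bartl's induction on the number of functionals [a j]: a solution [x] for
   the tail which violates the head functional is used to project along [x]
   onto the kernel of the head, where the induction hypothesis applies again. *)
Lemma farkas (I : finType) (J : eqType) (s : seq J) (a : J -> I -> R)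
    (g : I -> R) : uniq s ->
  (exists2 l : J -> R, (forall j, 0 <= l j) &
     forall i, g i = \sum_(j <- s) l j * a j i) \/
  (exists2 x : I -> R, (forall j, j \in s -> \sum_i a j i * x i <= 0) &
     0 < \sum_i g i * x i).
Proof.
elim: s a g => [|j s IHs] a g /= => [_|/andP[js us]].
  have [/forallP g0|/forallPn[i gi]] := boolP [forall i, g i == 0].
    by left; exists (fun=> 0) => // i; rewrite big_nil; apply/eqP.
  right; exists g => //.
  rewrite (bigD1 i) //= ltr_wpDr ?sumr_ge0// => [k _|]; first exact: sqr_ge0.
  by rewrite -expr2 exprn_even_gt0.
have [[l l0 gl]|[x sx gx]] := IHs a g us.
  left; exists (fun k => if k == j then 0 else l k) => [k|i].
    by case: ifP.
  rewrite big_cons eqxx mul0r add0r gl; apply: eq_big_seq => k ks.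
  by case: eqP => // kj; rewrite -kj ks in js.
have [jx|jx] := lerP (\sum_i a j i * x i) 0.
  by right; exists x => // k; rewrite inE => /predU1P[->|/sx].
(* The functional [f - d f * a j] vanishes at [x], hence factors through the projection along
   [x]. *)
pose d (f : I -> R) := (\sum_i f i * x i) / (\sum_i a j i * x i).
have [[l l0 gl]|[y sy gy]] := IHs (fun k i => a k i - d (a k) * a j i)
    (fun i => g i - d g * a j i) us.
  (* Undoing the projection leaves this coefficient on [a j]. It is nonnegative because [g] and
     [a j] are positive at [x] while the tail is nonpositive there. *)
  pose c := d g - \sum_(k <- s) l k * d (a k).
  have c0 : 0 <= c.
    rewrite subr_ge0; apply: (@le_trans _ _ 0).
      rewrite big_seq sumr_le0// => k ks.
      by rewrite mulr_ge0_le0// /d pmulr_lle0 ?invr_gt0// sx.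
    by rewrite /d divr_ge0 ?ltW.
  left; exists (fun k => if k == j then c else l k) => [k|i].
    by case: ifP.
  rewrite big_cons eqxx.
  have -> : \sum_(k <- s) (if k == j then c else l k) * a k i
      = \sum_(k <- s) l k * a k i.
    apply: eq_big_seq => k ks.
    by case: eqP => // kj; rewrite -kj ks in js.
  have := gl i; under eq_bigr do rewrite mulrBr mulrA.
  by rewrite sumrB -mulr_suml /c => /eqP; rewrite subr_eq => /eqP ->; ring.
(* With this [b] the point [y - b x] lies in the kernel of [a j]; by [dotE], any [f] takes there the
   value of its projection at [y]. *)
pose b := (\sum_i a j i * y i) / (\sum_i a j i * x i).
have dotE (f : I -> R) : \sum_i f i * (y i - b * x i) =
    \sum_i (f i - d f * a j i) * y i.
  under eq_bigr do rewrite mulrBr mulrCA.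
  under [RHS]eq_bigr do rewrite mulrBl -mulrA.
  by rewrite !sumrB -!mulr_sumr /b /d; ring.
right; exists (fun i => y i - b * x i) => [k|]; last by rewrite dotE.
rewrite inE => /predU1P[->|/sy]; last by rewrite dotE.
rewrite dotE big1// => i _.
by rewrite /d divff ?gt_eqF// mul1r subrr mul0r.
Qed.

(** This is half of weak duality: after exchanging the sums, each column bound is scaled by
    [y j]. *)
Lemma sum_dot_le (I J : finType) (A : I -> J -> R) (x : I -> R) (y c : J -> R) :
  (forall j, 0 <= y j) -> (forall j, \sum_i x i * A i j <= c j) ->
  \sum_i x i * (\sum_j A i j * y j) <= \sum_j c j * y j.
Proof.
move=> y0 xA; under eq_bigr do rewrite mulr_sumr.
rewrite exchange_big ler_sum//= => j _.
under eq_bigr do rewrite mulrA.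
by rewrite -mulr_suml ler_wpM2r.
Qed.

(* Farkas' lemma is applied to the homogenised system whose unknowns are a
   primal point, a dual point and a common scale. *)
Lemma lp_duality (E V : finType) (A : E -> V -> R) (b : V -> R) (c : E -> R)
    (w0 : E -> R) (t0 : V -> R) :
  (forall e, 0 <= w0 e) -> (forall v, \sum_e w0 e * A e v <= b v) ->
  (forall v, 0 <= t0 v) -> (forall e, c e <= \sum_v A e v * t0 v) ->
  exists w t,
    [/\ forall e, 0 <= w e, forall v, \sum_e w e * A e v <= b v,
        forall v, 0 <= t v, forall e, c e <= \sum_v A e v * t v
      & \sum_v b v * t v <= \sum_e c e * w e].
Proof.
move=> w00 w0A t00 t0A.
pose I := (E + V + unit)%type.
pose J := ((E + V) + (V + E) + unit)%type.
(* The rows express, in order, both sign conditions, primal feasibility, dual feasibility, and that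
   the dual value is at most the primal one. The constants [b] and [c] multiply the scale, which [g]
   reads off. *)
pose a (j : J) (i : I) : R := match j, i with
  | inl (inl (inl e)), inl (inl e') => - (e == e')%:R
  | inl (inl (inr v)), inl (inr v') => - (v == v')%:R
  | inl (inr (inl v)), inl (inl e) => A e v
  | inl (inr (inl v)), inr _ => - b v
  | inl (inr (inr e)), inl (inr v) => - A e v
  | inl (inr (inr e)), inr _ => c e
  | inr _, inl (inl e) => - c e
  | inr _, inl (inr v) => b v
  | _, _ => 0
  end.
pose g (i : I) : R := if i is inr _ then 1 else 0.
have sumI (F : I -> R) : \sum_i F i = \sum_e F (inl (inl e))
    + \sum_v F (inl (inr v)) + F (inr tt).
  by rewrite !big_sumType/= (big_pred1 tt)//; case.
have sumJ (F : J -> R) : \sum_j F j =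
    \sum_e F (inl (inl (inl e))) + \sum_v F (inl (inl (inr v)))
    + (\sum_v F (inl (inr (inl v))) + \sum_e F (inl (inr (inr e))))
    + F (inr tt).
  by rewrite !big_sumType/= (big_pred1 tt)//; case.
have delta (K : finType) (k : K) (F : K -> R) :
    \sum_k' - (k == k')%:R * F k' = - F k.
  rewrite (bigD1 k)//= eqxx big1 ?addr0 ?mulN1r// => k' /negbTE.
  by rewrite eq_sym => ->; rewrite oppr0 mul0r.
have delta' (K : finType) (k : K) (F : K -> R) :
    \sum_k' F k' * - (k' == k)%:R = - F k.
  by rewrite -delta; apply: eq_bigr => k' _; rewrite mulrC eq_sym.
have [[l l0 gl]|[x sx gx]] :=
    @farkas I J (index_enum J) a g (index_enum_uniq _).
  exfalso.
  (* The multipliers form feasible points scaled by [k]: [y] for the dual, [z] for the primal. *)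
  pose y v := l (inl (inr (inl v))); pose z e := l (inl (inr (inr e))).
  pose k := l (inr tt).
  have y0 v : 0 <= y v by exact: l0.
  have z0 e : 0 <= z e by exact: l0.
  have k0 : 0 <= k by exact: l0.
  have yA e : k * c e <= \sum_v A e v * y v.
    have := gl (inl (inl e)); rewrite sumJ /= delta'.
    rewrite [X in _ + X + _](_ : _ = \sum_v A e v * y v); last first.
      rewrite [X in _ + X]big1 ?addr0; last by move=> *; rewrite mulr0.
      by apply: eq_bigr => v _; rewrite mulrC.
    rewrite [X in _ + X + _ + _]big1; last by move=> *; rewrite mulr0.
    have := l0 (inl (inl (inl e))); rewrite -/k; lra.
  have zA v : \sum_e z e * A e v <= k * b v.
    have := gl (inl (inr v)); rewrite sumJ /= delta'.
    rewrite [X in _ + X + _](_ : _ = - \sum_e z e * A e v); last first.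
      rewrite [X in X + _]big1 ?add0r; last by move=> *; rewrite mulr0.
      by rewrite -sumrN; apply: eq_bigr => e _; rewrite mulrN.
    rewrite [X in X + _ + _ + _]big1; last by move=> *; rewrite mulr0.
    have := l0 (inl (inl (inr v))); rewrite -/k; lra.
  have zy : 1 = \sum_e z e * c e - \sum_v y v * b v.
    have := gl (inr tt); rewrite sumJ /= mulr0 addr0.
    rewrite [X in X + _ + _]big1; last by move=> *; rewrite mulr0.
    rewrite [X in _ + X + _]big1; last by move=> *; rewrite mulr0.
    rewrite !add0r => h; rewrite [LHS]h addrC -sumrN.
    by congr (_ + _); apply: eq_bigr => v _; rewrite mulrN.
  have kzy : k * (\sum_e z e * c e) <= k * (\sum_v y v * b v).
    apply: (@le_trans _ _ (\sum_e z e * (\sum_v A e v * y v))).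
      rewrite mulr_sumr ler_sum// => e _.
      by rewrite mulrCA ler_wpM2l.
    apply: le_trans (sum_dot_le y0 zA) _.
    by rewrite mulr_sumr ler_sum// => v _; rewrite (mulrC (y v)) mulrA.
  (* For positive [k], weak duality [kzy] would contradict [zy]. *)
  have k00 : k = 0.
    by apply/eqP; rewrite eq_le k0 andbT; move: kzy zy; nra.
  (* Once [k = 0], pairing [z] with [t0] and [y] with [w0] forces the right side of [zy] to be at
     most 0. *)
  have : \sum_e z e * c e <= 0.
    apply: (@le_trans _ _ (\sum_e z e * (\sum_v A e v * t0 v))).
      by rewrite ler_sum// => e _; rewrite ler_wpM2l.
    apply: le_trans (sum_dot_le t00 zA) _.
    by rewrite big1// => v _; rewrite k00 !mul0r.
  have : 0 <= \sum_v y v * b v.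
    apply: (@le_trans _ _ (\sum_e w0 e * (\sum_v A e v * y v))).
      rewrite sumr_ge0// => e _; rewrite mulr_ge0//.
      by apply: le_trans (yA e); rewrite k00 mul0r.
    apply: le_trans (sum_dot_le y0 w0A) _.
    by rewrite ler_sum// => v _; rewrite mulrC.
  by move: zy; lra.
have zero (K : finType) (F : K -> R) : \sum_k 0 * F k = 0.
  by apply: big1 => k _; rewrite mul0r.
(* The scale is positive, so dividing by it dehomogenises the solution. *)
pose s := x (inr tt).
have s0 : 0 < s.
  by move: gx; rewrite sumI /= !zero !add0r mul1r.
have s10 : 0 <= s^-1 by rewrite invr_ge0 ltW.
have {sx}sx j : \sum_i a j i * x i <= 0 by apply: sx; rewrite mem_index_enum.
exists (fun e => s^-1 * x (inl (inl e))), (fun v => s^-1 * x (inl (inr v))).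
split.
- move=> e; rewrite mulr_ge0//.
  have := sx (inl (inl (inl e))); rewrite sumI /= delta zero; lra.
- move=> v; under eq_bigr do rewrite -mulrA.
  rewrite -mulr_sumr mulrC ler_pdivrMr//.
  have := sx (inl (inr (inl v))); rewrite sumI /= zero -/s.
  under eq_bigr do rewrite mulrC.
  lra.
- move=> v; rewrite mulr_ge0//.
  have := sx (inl (inl (inr v))); rewrite sumI /= delta zero; lra.
- move=> e; under eq_bigr do rewrite mulrCA.
  rewrite -mulr_sumr mulrC ler_pdivlMr//.
  have := sx (inl (inr (inr e))); rewrite sumI /= zero -/s.
  under eq_bigr do rewrite mulNr.
  rewrite sumrN; lra.
- under eq_bigr do rewrite mulrCA.
  under [leRHS]eq_bigr do rewrite mulrCA.
  rewrite -!mulr_sumr ler_wpM2l//.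
  have := sx (inr tt); rewrite sumI /=.
  under eq_bigr do rewrite mulNr.
  rewrite sumrN; lra.
Qed.

End LinearProgramming.

(** * Fractional covers and their duality with matchings *)

Definition fractional_cover (R : realType) (T : finType)
    (H : {set {set T}}) (t : T -> R) : Prop :=
  (forall v, 0 <= t v) /\ (forall e, e \in H -> 1 <= \sum_(v in e) t v).

Section FractionalCovers.
Variables (R : realType) (T : finType).
Implicit Types (H : {set {set T}}) (w : {set T} -> R) (t : T -> R).

(** Both sides add up [w e * t v] over the incident pairs. *)
Lemma matching_cover_exchange H w t :
  \sum_(e in H) w e * (\sum_(v in e) t v) =
  \sum_v t v * (\sum_(e in H | v \in e) w e).
Proof.
under eq_bigr do rewrite mulr_sumr.
rewrite (exchange_big_dep predT)//=; apply: eq_bigr => v _.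
by rewrite mulr_sumr; apply: eq_bigr => e _; rewrite mulrC.
Qed.

Lemma matching_le_cover H w t :
  fractional_matching H w -> fractional_cover H t ->
  \sum_(e in H) w e <= \sum_v t v.
Proof.
move=> [w0 w1] [t0 t1].
apply: (@le_trans _ _ (\sum_(e in H) w e * (\sum_(v in e) t v))).
  by apply: ler_sum => e eH; rewrite ler_peMr ?w0 ?t1.
rewrite matching_cover_exchange; apply: ler_sum => v _.
by rewrite ler_piMr.
Qed.

(** The total slacks on the edge side and on the vertex side are nonnegative and opposite to each
    other, so every single slack term vanishes. *)
Lemma complementary_slackness H w t :
  fractional_matching H w -> fractional_cover H t ->
  \sum_v t v = \sum_(e in H) w e ->
  (forall e, e \in H -> 0 < w e -> \sum_(v in e) t v = 1) /\
  (forall v, 0 < t v -> \sum_(e in H | v \in e) w e = 1).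
Proof.
move=> [w0 w1] [t0 t1] tw.
pose m := \sum_(e in H) w e * (\sum_(v in e) t v).
have le1 e : e \in H -> 0 <= w e * (\sum_(v in e) t v - 1).
  by move=> eH; rewrite mulr_ge0 ?w0// subr_ge0 t1.
have le2 v : 0 <= t v * (1 - \sum_(e in H | v \in e) w e).
  by rewrite mulr_ge0// subr_ge0.
have E1 : \sum_(e in H) w e * (\sum_(v in e) t v - 1) = m - \sum_v t v.
  by rewrite tw -sumrB; apply: eq_bigr => e _; rewrite mulrBr mulr1.
have E2 : \sum_v t v * (1 - \sum_(e in H | v \in e) w e) = \sum_v t v - m.
  rewrite /m matching_cover_exchange -sumrB.
  by apply: eq_bigr => v _; rewrite mulrBr mulr1.
have S1 : 0 <= m - \sum_v t v by rewrite -E1 sumr_ge0.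
have S2 : 0 <= \sum_v t v - m by rewrite -E2 sumr_ge0.
have m0 : m - \sum_v t v = 0 by lra.
split=> [e eH we|v tv].
  have /eqP := psumr_eq0P le1 (etrans E1 m0) eH.
  by rewrite mulf_eq0 gt_eqF//= subr_eq0 => /eqP.
have m0' : \sum_v t v - m = 0 by lra.
have /eqP := psumr_eq0P (fun v (_ : predT v) => le2 v) (etrans E2 m0') (isT : predT v).
by rewrite mulf_eq0 gt_eqF//= subr_eq0 => /eqP.
Qed.

Lemma nu_star_le_cover H t :
  fractional_cover H t -> nu_star R H <= \sum_v t v.
Proof.
move=> Ht; apply: ge_sup => [|_ [w Hw ->]]; last exact: matching_le_cover.
(* The zero matching makes the set under the supremum nonempty. *)
exists (\sum_(e in H) 0), (fun=> 0) => //; split=> // v.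
by rewrite big1 ?ler01.
Qed.

(** The cover [t] serves to bound the set of matching weights, so that its supremum is an upper
    bound. *)
Lemma matching_le_nu_star H w t :
  fractional_matching H w -> fractional_cover H t ->
  \sum_(e in H) w e <= nu_star R H.
Proof.
move=> Hw Ht; apply: ub_le_sup; last by exists w.
by exists (\sum_v t v) => _ [w' Hw' ->]; exact: matching_le_cover.
Qed.

(** Duality is applied to the incidence matrix indexed by all subsets of [T], with zero row and zero
    objective off [H]. Nonemptiness of the edges makes the constant 1 a feasible cover. *)
Lemma optimal_matching_cover H : (forall e, e \in H -> e != finset.set0) ->
  exists w t, [/\ fractional_matching H w, fractional_cover H t,
    \sum_v t v = \sum_(e in H) w e & \sum_v t v = nu_star R H].
Proof.
move=> H0.
pose A (e : {set T}) (v : T) : R := ((e \in H) && (v \in e))%:R.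
have sumAr t e : e \in H -> \sum_v A e v * t v = \sum_(v in e) t v.
  move=> eH; rewrite [RHS]big_mkcond; apply: eq_bigr => v _.
  by rewrite /A eH /=; case: ifP; rewrite ?mul1r ?mul0r.
have sumAl w v : \sum_e w e * A e v = \sum_(e in H | v \in e) w e.
  rewrite [RHS]big_mkcond; apply: eq_bigr => e _.
  by rewrite /A; case: ifP; rewrite ?mulr1 ?mulr0.
have [] := @lp_duality R _ _ A (fun=> 1) (fun e => (e \in H)%:R)
    (fun=> 0) (fun=> 1).
- by [].
- by move=> v; rewrite big1 ?ler01// => e _; rewrite mul0r.
- by move=> v; exact: ler01.
- move=> e; have [eH|eH] := boolP (e \in H); last first.
    by apply: sumr_ge0 => v _; rewrite mulr1 ler0n.
  rewrite sumAr//; have /finset.set0Pn[v ve] := H0 e eH.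
  by rewrite (bigD1 v)//= lerDl sumr_ge0.
move=> w [t [w0 w1 t0 t1 tw]].
have Hw : fractional_matching H w by split=> // v; rewrite -sumAl.
have Ht : fractional_cover H t.
  by split=> // e eH; rewrite -sumAr//; apply: le_trans (t1 e); rewrite eH.
have twE : \sum_v t v = \sum_(e in H) w e.
  apply/eqP; rewrite eq_le matching_le_cover// andbT.
  under eq_bigr do rewrite -[t _]mul1r.
  apply: le_trans tw _; rewrite [leRHS]big_mkcond ler_sum// => e _.
  by case: (e \in H); rewrite ?mul1r ?mul0r.
exists w, t; split=> //; apply/eqP; rewrite eq_le nu_star_le_cover// andbT.
by rewrite twE; exact: matching_le_nu_star Ht.
Qed.

(** Setting [t] to 0 on [e :\ v] removes weight exactly 1, since [v] carries none, and surviving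
    edges avoid the zeroed vertices. *)
Lemma nu_star_hdel_tight H t (e : {set T}) (v : T) :
  fractional_cover H t -> v \in e -> \sum_(u in e) t u = 1 -> t v = 0 ->
  nu_star R (hdel H (e :\ v)%SET) <= \sum_u t u - 1.
Proof.
move=> [t0 t1] ve te tv.
pose t' u := if u \in (e :\ v)%SET then 0 else t u.
have -> : \sum_u t u - 1 = \sum_u t' u.
  rewrite -te (bigD1 v ve)/= tv add0r.
  rewrite [X in X - _](bigID (mem (e :\ v)%SET))/=.
  rewrite [X in X + _ - _](eq_bigl (fun u => (u \in e) && (u != v))); last first.
    by move=> u; rewrite !inE andbC.
  rewrite addrAC subrr add0r big_mkcond; apply: eq_bigr => u _.
  by rewrite /t' if_neg.
apply: nu_star_le_cover; split=> [u|f]; first by rewrite /t'; case: ifP.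
rewrite inE => /andP[fH dis]; rewrite (eq_bigr t) ?t1// => u uf.
by rewrite /t' (disjointFr dis uf).
Qed.

Lemma sum_indicator (S A : {set T}) :
  \sum_(v in S) (v \in A)%:R = #|S :&: A|%:R :> R.
Proof.
rewrite -sum1_card natr_sum big_mkcond [RHS]big_mkcond.
by apply: eq_bigr => v _; rewrite inE; case: (v \in S); case: (v \in A).
Qed.

(* Double counting: each edge meets the side [A] once, so [#|A :&: P|] is the
   total weight of [w]. *)
Lemma card_saturated_side H w (A P : {set T}) :
  (forall e, e \in H -> #|e :&: A| = 1%N) ->
  (forall v, \sum_(e in H | v \in e) w e = (v \in P)%:R) ->
  #|A :&: P|%:R = \sum_(e in H) w e.
Proof.
move=> HA wP.
pose t (v : T) : R := (v \in A)%:R.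
have sumt (B : {set T}) : \sum_(v in B) t v = #|B :&: A|%:R.
  exact: sum_indicator.
rewrite finset.setIC -sumt.
have -> : \sum_(e in H) w e = \sum_(e in H) w e * (\sum_(v in e) t v).
  by apply: eq_bigr => e eH; rewrite sumt HA// mulr1.
rewrite matching_cover_exchange big_mkcond; apply: eq_bigr => v _.
by rewrite wP; case: (v \in P); rewrite ?mulr1 ?mulr0.
Qed.

End FractionalCovers.

(** * Shifting an optimal cover between two sides *)

Theorem theorem29 (R : realType) (T : finType) (r : nat) (H : {set {set T}})
    (hr : (2 <= r)%N) (Hpart : rpartite r H) (Hedge : exists e, e \in H) :
  exists (e : {set T}) (v : T),
    [/\ e \in H, v \in e &
        nu_star R (hdel H (e :\ v)%SET) <= nu_star R H - 1].
Proof.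
case: Hpart => sides [/and3P[_ /finset.trivIsetP triv _] cards HA].
have /card_gt1P[A [B [As Bs AB]]] : (1 < #|sides|)%N by rewrite cards.
have HdA e : e \in H -> #|e :&: A| = 1%N by move=> eH; exact: HA.
have HdB e : e \in H -> #|e :&: B| = 1%N by move=> eH; exact: HA.
have disAB := triv _ _ As Bs AB.
have H0 e : e \in H -> e != finset.set0.
  by move=> /HdA; apply: contra_eq_neq => ->; rewrite finset.set0I cards0.
have [w [t [Hw Ht tw tnu]]] := @optimal_matching_cover R T H H0.
have finish t' e v : fractional_cover H t' -> \sum_u t' u = \sum_u t u ->
    e \in H -> v \in e -> \sum_(u in e) t' u = 1 -> t' v = 0 ->
    exists (e : {set T}) (v : T), [/\ e \in H, v \in e &
        nu_star R (hdel H (e :\ v)%SET) <= nu_star R H - 1].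
  move=> Ht' t't eH ve te tv; exists e, v; split=> //.
  by rewrite -tnu -t't; exact: nu_star_hdel_tight.
have [/existsP[e /andP[eH /existsP[v /and3P[ve /eqP tv /eqP te]]]]|tight] :=
    boolP [exists e, (e \in H) &&
      [exists v, [&& v \in e, t v == 0 & \sum_(u in e) t u == 1]]].
  exact: (finish t e v).
have {}tight e v : e \in H -> v \in e -> t v = 0 -> \sum_(u in e) t u <> 1.
  move=> eH ve tv te; move/negP: tight; apply; apply/existsP; exists e.
  by rewrite eH; apply/existsP; exists v; rewrite ve tv te !eqxx.
have [t0 t1] := Ht; have [w0 w1] := Hw.
have [wt tw1] := complementary_slackness Hw Ht tw.
pose P := [set v | 0 < t v]%SET.
(* An edge of positive [w]-weight through a vertex with [t v = 0] would be tight by slackness,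
   against [tight]. *)
have wP v : \sum_(e in H | v \in e) w e = (v \in P)%:R.
  rewrite inE; have [tv|] := ltrP 0 (t v); first exact: tw1.
  move=> tv; have {}tv : t v = 0 by apply/eqP; rewrite eq_le tv t0.
  apply: big1 => e /andP[eH ve]; apply/eqP; apply: contraT => we.
  by case: (tight e v eH ve tv); apply: wt => //; rewrite lt_def we w0.
have cardA := card_saturated_side HdA wP.
have cardB := card_saturated_side HdB wP.
(* Otherwise the total weight of [t] would be 0 and no edge would be covered. The vertex [v0] starts
   the minimisation below. *)
have [v0 v0A] : exists v, v \in A :&: P.
  apply/finset.set0Pn/negP => /eqP AP0; move: cardA.
  rewrite AP0 cards0 -tw => t00; case: Hedge => e eH.
  have := t1 e eH; have : \sum_(u in e) t u <= \sum_u t u.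
    rewrite [leRHS](bigID (mem e))/= lerDl; exact: sumr_ge0.
  by rewrite -t00; lra.
(* These are the edges that lose weight when [t] is lowered on [A :&: P] and raised on [B :&: P]. *)
pose bad := [set f in H | (f :&: (A :&: P) != finset.set0) &&
                          (f :&: (B :&: P) == finset.set0)]%SET.
(* The shift can be stopped by a vertex of [A :&: P] reaching 0 or by a bad edge becoming tight; [F]
   is the amount at which this happens, and [eps] the least one. *)
pose Q (i : T + {set T}) :=
  match i with inl v => v \in A :&: P | inr f => f \in bad end.
pose F (i : T + {set T}) : R :=
  match i with inl v => t v | inr f => \sum_(u in f) t u - 1 end.
case: (@arg_minP _ _ _ (inl v0) Q F v0A) => i0 Qi0 min_i0.
set eps := F i0 in min_i0.
have eps0 : 0 <= eps.
  rewrite /eps; case: (i0) Qi0 => [v _|f] /=; first exact: t0.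
  by rewrite inE => /andP[fH _]; rewrite subr_ge0 t1.
pose t' v := t v - eps * (v \in A :&: P)%:R + eps * (v \in B :&: P)%:R.
have sumt' (S : {set T}) : \sum_(v in S) t' v = \sum_(v in S) t v
    - eps * #|S :&: (A :&: P)|%:R + eps * #|S :&: (B :&: P)|%:R.
  by rewrite big_split sumrB -!mulr_sumr !sum_indicator.
(* The two parts [A :&: P] and [B :&: P] have the same size, so loss and gain cancel. *)
have tot : \sum_v t' v = \sum_v t v.
  have := sumt' finset.setT; rewrite !finset.setTI cardA cardB subrK.
  by rewrite !(eq_bigl predT) // => v; rewrite inE.
have capA f : f \in H -> (#|f :&: (A :&: P)| <= 1)%N.
  by move=> fH; rewrite -(HdA f fH) finset.setIA subset_leq_card ?finset.subsetIl.
have Ht' : fractional_cover H t'.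
  split=> [v|f fH].
    have epsB : 0 <= eps * (v \in B :&: P)%:R by rewrite mulr_ge0.
    rewrite /t' addr_ge0//; case vA: (v \in A :&: P); last first.
      by rewrite mulr0 subr0.
    by rewrite mulr1 subr_ge0; exact: (min_i0 (inl v)).
  have cA : #|f :&: (A :&: P)|%:R <= 1 :> R by rewrite lern1 capA.
  have tf := t1 f fH; rewrite sumt'.
  (* An edge missing [A :&: P] loses nothing, a bad edge has slack at least [eps], and any other
     edge regains on [B] what it loses on [A]. *)
  have [fA|fA] := eqVneq (f :&: (A :&: P)) finset.set0.
    have : 0 <= eps * #|f :&: (B :&: P)|%:R by rewrite mulr_ge0.
    by rewrite fA cards0 mulr0; lra.
  have [fB|fB] := eqVneq (f :&: (B :&: P)) finset.set0.
    have := min_i0 (inr f); rewrite /= inE fH fA fB eqxx /= => /(_ isT).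
    by rewrite cards0; nra.
  have : 1 <= #|f :&: (B :&: P)|%:R :> R by rewrite ler1n card_gt0.
  by nra.
have tw' : \sum_v t' v = \sum_(e in H) w e by rewrite tot.
case Ei: i0 Qi0 => [v|f] /= Qi0.
- have epsE : eps = t v by rewrite /eps Ei.
  have vB : v \notin B :&: P.
    move: Qi0; rewrite !inE => /andP[vA _].
    by rewrite (disjointFr disAB vA).
  (* As [w] saturates [v], some edge of positive weight contains it; that edge is tight for [t'],
     which is still optimal. *)
  have [e /andP[/andP[eH ve] we]] : exists e, ((e \in H) && (v \in e)) && (0 < w e).
    apply: psumr_neq0P => [e /andP[eH _]|]; first exact: w0.
    move: Qi0; rewrite wP inE => /andP[_ ->]; exact/eqP/oner_neq0.
  apply: (finish t' e v) => //.
    by have [+ _] := complementary_slackness Hw Ht' tw'; exact.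
  by rewrite /t' Qi0 (negbTE vB) epsE mulr1 mulr0 addr0 subrr.
- have epsE : eps = \sum_(u in f) t u - 1 by rewrite /eps Ei.
  move: Qi0; rewrite inE => /and3P[fH fA /eqP fB].
  (* The vertex of the bad edge [f] on side [B] lies outside [P], so it has weight 0 and the shift
     leaves it there. *)
  have [u /finset.setIP[uf uB]] : exists u, u \in f :&: B.
    by apply/finset.set0Pn; rewrite -card_gt0 HdB.
  have uBP : u \notin B :&: P.
    by apply/negP => uBP; have := finset.in_set0 u; rewrite -fB inE uf uBP.
  have tu : t u = 0.
    move: uBP; rewrite !inE uB /= -leNgt => tu.
    by apply/eqP; rewrite eq_le tu t0.
  apply: (finish t' f u) => //.
    rewrite sumt' fB cards0 (_ : #|_| = 1%N) ?epsE; first by ring.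
    by apply/eqP; rewrite eqn_leq capA// card_gt0.
  by rewrite /t' tu (negbTE uBP) inE (disjointFl disAB uB) !mulr0 subrr addr0.
Qed.
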